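(* Let $G$ be a Lie group endowed with a fixed right-invariant Riemannian metric $\langle\cdot,\cdot\rangle_G$, and let $g$ be the metric on $E^{\mathrm{sph}}(G)$ defined by the local metrics $g_I=\sum_{i\in I}dx_i^2+\sum_{i\in I}x_i^2\langle\cdot,\cdot\rangle_G^{(i)}$ on $S_I\times G^I$. Then $g$ is smooth in the diffeological sense: for every plot $p:U\to E^{\mathrm{sph}}(G)$, the pullback $p^*g$ is a smooth symmetric covariant $2$-tensor on $U$.
   Context: Spherical Milnor space: $E^{\mathrm{sph}}(G)$ is the set of families $(x_i,g_i)_{i\in\mathbb N}$ with $x_i\in\mathbb R$ finitely supported, $\sum_i x_i^2=1$, $g_i\in G$, modulo $(x_i,g_i)\sim(x_i,g_i')$ iff $g_i=g_i'$ whenever $x_i\ne0$. For finite $I\subset\mathbb N$, $S_I=\{x\in\mathbb R^I:\sum_{i\in I}x_i^2=1\}$ and $\psi_I:S_I\times G^I\to E^{\mathrm{sph}}(G)$ is extension by zero followed by passage to the quotient. $E^{\mathrm{sph}}(G)$ carries the final diffeology generated by the $\psi_I$: a map $p:U\to E^{\mathrm{sph}}(G)$ ($U$ open in a Euclidean space) is a plot iff locally $p=\psi_I\circ\widetilde p$ for some finite $I$ and some smooth $\widetilde p$ with values in $S_I\times G^I$. $\langle\cdot,\cdot\rangle_G^{(i)}$ is the metric on the $i$-th copy of $G$. The pullback $p^*g$ is defined by $(p^*g)|_V=\widetilde p^{\,*}g_I$ whenever $V\subset U$ is open, $I\subset\mathbb N$ is finite, $\widetilde p:V\to S_I\times G^I$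 is smooth and $p|_V=\psi_I\circ\widetilde p$. *)

(* Defs.v *)
From HB Require Import structures.
From mathcomp Require Import all_boot all_order all_algebra finmap generic_quotient.
From mathcomp Require Import all_classical all_reals all_analysis.
Set Implicit Arguments.
Unset Strict Implicit.
Unset Printing Implicit Defensive.
Import Order.TTheory GRing.Theory Num.Theory.
Import numFieldNormedType.Exports.
Local Open Scope classical_set_scope.
Local Open Scope quotient_scope.
Local Open Scope ring_scope.

(* Meant for an open subset A of a finite-dimensional V: C^(k+1) means
   differentiable with all directional derivatives of class C^k. *)
Fixpoint Ck_on (R : realType) (V W : normedModType R) (k : nat) (A : set V)
    (f : V -> W) : Prop :=
  match k with
  | 0 => forall u, A u -> {for u, continuous f}
  | k'.+1 => (forall u, A u -> differentiable f u) /\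
             (forall v : V, Ck_on k' A ('D_v f))
  end.

Definition smooth_on (R : realType) (V W : normedModType R) (A : set V)
  (f : V -> W) : Prop := forall k, Ck_on k A f.

(* The total functions [chart a] and [chart_inv a] only matter on
   [chart_dom a] and on its image respectively. *)
HB.mixin Record isManifold (R : realType) (m : nat) M of Topological M := {
  atlas : Type;
  chart_dom : atlas -> set M;
  chart : atlas -> M -> 'rV[R]_m;
  chart_inv : atlas -> 'rV[R]_m -> M;
  chart_cover : forall q : M, exists a, chart_dom a q;
  chart_dom_open : forall a, open (chart_dom a);
  chart_cod_open : forall a, open (chart a @` chart_dom a);
  chartK : forall a q, chart_dom a q -> chart_inv a (chart a q) = q;
  chart_continuous : forall a q, chart_dom a q ->
    {for q, continuous (chart a)};
  chart_inv_continuous : forall a y, (chart a @` chart_dom a) y ->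
    {for y, continuous (chart_inv a)};
  chart_transition : forall a b,
    smooth_on (chart a @` (chart_dom a `&` chart_dom b))
              (chart b \o chart_inv a);
  manifold_hausdorff : hausdorff_space M;
  manifold_second_countable : @second_countable M
}.

#[short(type="manifoldType")]
HB.structure Definition Manifold (R : realType) (m : nat) :=
  {M of isManifold R m M & Topological M}.

Section Tangent.
Context (R : realType) (m : nat) (M : manifoldType R m).
Local Notation atlas := (@atlas R m M).

Definition chart_cod (a : atlas) : set 'rV[R]_m := chart a @` chart_dom a.

(* Smooth maps from an open subset A of V to M. *)
Definition smooth_into (V : normedModType R) (A : set V) (f : V -> M) : Prop :=
  (forall u, A u -> {for u, continuous f}) /\
  (forall a : atlas, smooth_on (A `&` f @^-1` chart_dom a) (chart a \o f)).

(* A tangent vector at q is the family of its coordinates in all the charts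
   around q, subject to the transformation law; the entries at the charts whose
   domain misses q are set to 0, so that T_q M is a linear subspace of tvec. *)
Definition tvec : Type := atlas -> 'rV[R]_m.

Definition tangent (q : M) : set tvec := [set xi : tvec |
  (forall a b, chart_dom a q -> chart_dom b q ->
     xi b = 'D_(xi a) (chart b \o chart_inv a) (chart a q)) /\
  (forall a, ~ chart_dom a q -> xi a = 0)].

(* The tangent vector df_u(v) at f u. *)
Definition pushforward (V : normedModType R) (f : V -> M) (u v : V) : tvec :=
  fun a => if `[< chart_dom a (f u) >] then 'D_v (chart a \o f) u else 0.

Definition chart_at (q : M) : atlas := projT1 (cid (chart_cover q)).

(* The differential d(phi)_q : T_q M -> T_(phi q) M, read in a chart at q. *)
Definition tangent_map (phi : M -> M) (q : M) (xi : tvec) : tvec :=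
  pushforward (phi \o chart_inv (chart_at q)) (chart (chart_at q) q)
    (xi (chart_at q)).

(* The i-th coordinate vector field of the chart a, at the point of
   coordinates y. *)
Definition coord_field (a : atlas) (i : 'I_m) (y : 'rV[R]_m) : tvec :=
  pushforward (chart_inv a) y (delta_mx 0 i).

(* Only the values of [ip q] on [tangent q] are meaningful. *)
Record riemannian_metric (ip : M -> tvec -> tvec -> R) : Prop := {
  riemannian_linear : forall q (c : R) (xi xi' eta : tvec),
    tangent q xi -> tangent q xi' -> tangent q eta ->
    ip q (c *: xi + xi') eta = c * ip q xi eta + ip q xi' eta;
  riemannian_sym : forall q (xi eta : tvec),
    tangent q xi -> tangent q eta -> ip q xi eta = ip q eta xi;
  riemannian_pos : forall q (xi : tvec),
    tangent q xi -> xi <> 0 -> 0 < ip q xi xi;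
  riemannian_smooth : forall (a : atlas) (i j : 'I_m),
    smooth_on (chart_cod a)
      (fun y => ip (chart_inv a y) (coord_field a i y) (coord_field a j y))
}.

End Tangent.

HB.mixin Record isLieGroup (R : realType) (m : nat) G
    of Manifold R m G & Group G := {
  lie_mul_smooth : forall a b : @atlas R m G,
    smooth_into (chart_cod a `*` chart_cod b)
      (fun z : 'rV[R]_m * 'rV[R]_m =>
         (chart_inv a z.1 * chart_inv b z.2)%g : G);
  lie_inv_smooth : forall a : @atlas R m G,
    smooth_into (chart_cod a) (fun y => (chart_inv a y)^-1%g : G)
}.

#[short(type="lieGroupType")]
HB.structure Definition LieGroup (R : realType) (m : nat) :=
  {G of isLieGroup R m G & Manifold R m G & Group G}.

Definition right_invariant (R : realType) (m : nat) (G : lieGroupType R m)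
    (ip : G -> tvec G -> tvec G -> R) : Prop :=
  forall (h q : G) (xi eta : tvec G), tangent q xi -> tangent q eta ->
    let Rh := fun x : G => (x * h)%g in
    ip (Rh q) (tangent_map Rh q xi) (tangent_map Rh q eta) = ip q xi eta.

Section MilnorSpace.
Context (R : realType) (G : groupType).

Record milnor_family := MilnorFamily {
  milnor_coef : {fsfun nat -> R with 0};
  milnor_elt : nat -> G;
  milnor_norm : \sum_(i <- finsupp milnor_coef) milnor_coef i ^+ 2 = 1
}.

HB.instance Definition _ := gen_eqMixin milnor_family.
HB.instance Definition _ := gen_choiceMixin milnor_family.

Definition milnor_rel (s t : milnor_family) : bool :=
  `[< milnor_coef s = milnor_coef t /\
      forall i, milnor_coef s i != 0 -> milnor_elt s i = milnor_elt t i >].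

Lemma milnor_rel_equiv : equiv_class_of milnor_rel.
Proof.
split=> [s|s t|t s u].
- exact/asboolP.
- by apply/asboolP/asboolP => -[e h]; split=> // i hi;
    rewrite h // ?e // -e.
- move=> /asboolP[e h] /asboolP[e' h']; apply/asboolP; split; first by rewrite e.
  by move=> i hi; rewrite h // h' // -e.
Qed.

Canonical milnor_equiv := EquivRelPack milnor_rel_equiv.

Definition Esph : Type := {eq_quot milnor_equiv}.

Record sphere (I : {fset nat}) := Sphere {
  sphere_val :> {ffun I -> R};
  sphere_norm : \sum_i sphere_val i ^+ 2 = 1
}.

Definition ext_coef (I : {fset nat}) (x : {ffun I -> R}) :
  {fsfun nat -> R with 0} := [fsfun i : I => x i | 0].

Lemma ext_coef_norm (I : {fset nat}) (x : sphere I) :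
  \sum_(i <- finsupp (ext_coef x)) ext_coef x i ^+ 2 = 1.
Proof.
rewrite -(sphere_norm x) (big_fset_incl _ (B := I)) /=.
- rewrite big_seq_fsetE /=; apply: eq_bigr => i _.
  by rewrite fsfun_ffun valK.
- apply/fsubsetP => i; rewrite mem_finsupp fsfun_ffun.
  by case: insubP => //=; rewrite eqxx.
- by move=> i _; rewrite memNfinsupp => /eqP ->; rewrite expr0n.
Qed.

(* The value 1 outside I is arbitrary: it is forgotten by the quotient. *)
Definition ext_elt (I : {fset nat}) (gam : {ffun I -> G}) (i : nat) : G :=
  if insub i is Some j then gam j else 1%g.

Definition psi (I : {fset nat}) (z : sphere I * {ffun I -> G}) : Esph :=
  \pi_Esph (MilnorFamily (ext_elt z.2) (ext_coef_norm z.1)).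

End MilnorSpace.

Section MilnorMetric.
Context (R : realType) (m : nat) (G : lieGroupType R m).
Context (ip : G -> tvec G -> tvec G -> R).
Context (n : nat).

(* S_I is a submanifold of R^I, so smoothness into S_I * G^I is
   componentwise. *)
Definition smooth_lift (I : {fset nat}) (V : set 'rV[R]_n)
    (pt : 'rV[R]_n -> sphere R I * {ffun I -> G}) : Prop :=
  (forall i : I, smooth_on V (fun u => (pt u).1 i)) /\
  (forall i : I, smooth_into V (fun u => (pt u).2 i)).

Definition is_lift (p : 'rV[R]_n -> Esph R G) (I : {fset nat})
    (V : set 'rV[R]_n) (pt : 'rV[R]_n -> sphere R I * {ffun I -> G}) : Prop :=
  smooth_lift V pt /\ (forall u, V u -> p u = psi (pt u)).

(* Only the values of p on U matter. *)
Definition plot (U : set 'rV[R]_n) (p : 'rV[R]_n -> Esph R G) : Prop :=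
  open U /\
  forall u, U u -> exists V, [/\ open V, V u, V `<=` U &
    exists (I : {fset nat}) (pt : 'rV[R]_n -> sphere R I * {ffun I -> G}),
      is_lift p V pt].

(* A tangent vector of S_I * G^I is given by its components: (dx_i)_i and,
   for each i, a tangent vector of the i-th copy of G. *)
Definition local_metric (I : {fset nat}) (z : sphere R I * {ffun I -> G})
    (X Y : (I -> R) * (I -> tvec G)) : R :=
  \sum_(i : I) X.1 i * Y.1 i +
  \sum_(i : I) z.1 i ^+ 2 * ip (z.2 i) (X.2 i) (Y.2 i).

Definition lift_differential (I : {fset nat})
    (pt : 'rV[R]_n -> sphere R I * {ffun I -> G}) (u v : 'rV[R]_n) :
    (I -> R) * (I -> tvec G) :=
  (fun i => 'D_v (fun w => (pt w).1 i) u,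
   fun i => pushforward (fun w => (pt w).2 i) u v).

Definition local_pullback (I : {fset nat})
    (pt : 'rV[R]_n -> sphere R I * {ffun I -> G}) (u v w : 'rV[R]_n) : R :=
  local_metric (pt u) (lift_differential pt u v) (lift_differential pt u w).

(* T is p^*g on U. *)
Definition is_pullback (U : set 'rV[R]_n) (p : 'rV[R]_n -> Esph R G)
    (T : 'rV[R]_n -> 'rV[R]_n -> 'rV[R]_n -> R) : Prop :=
  forall (V : set 'rV[R]_n) (I : {fset nat})
    (pt : 'rV[R]_n -> sphere R I * {ffun I -> G}),
    open V -> V `<=` U -> is_lift p V pt ->
    forall u v w, V u -> T u v w = local_pullback pt u v w.

End MilnorMetric.

Record smooth_symmetric_tensor (R : realType) (n : nat) (U : set 'rV[R]_n)
    (T : 'rV[R]_n -> 'rV[R]_n -> 'rV[R]_n -> R) : Prop := {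
  tensor_linear_l : forall u (c : R) v v' w, U u ->
    T u (c *: v + v') w = c * T u v w + T u v' w;
  tensor_linear_r : forall u (c : R) v w w', U u ->
    T u v (c *: w + w') = c * T u v w + T u v w';
  tensor_sym : forall u v w, U u -> T u v w = T u w v;
  tensor_smooth : forall i j : 'I_n,
    smooth_on U (fun u => T u (delta_mx 0 i) (delta_mx 0 j))
}.

(* Main.v *)
Require Import Defs.
From HB Require Import structures.
From mathcomp Require Import all_boot all_order all_algebra finmap generic_quotient.
From mathcomp Require Import all_classical all_reals all_analysis.
Set Implicit Arguments.
Unset Strict Implicit.
Unset Printing Implicit Defensive.
Import Order.TTheory GRing.Theory Num.Theory.
Import numFieldNormedType.Exports.
(* Imported again so that pushforward means the differential of a map, not the
   image measure. *)
Import Defs.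
Local Open Scope classical_set_scope.
Local Open Scope ring_scope.

(** Near a point, a plot p lifts through some psi_I, and the pullback metric is
    the sum over i in I of

      dx_i(v) dx_i(w) + x_i^2 <dg_i(v), dg_i(w)>,

    which is visibly symmetric, bilinear and smooth: in a chart of G the inner
    product becomes a combination of products of partial derivatives of g_i,
    with the metric coefficients composed with g_i as coefficients
    ([riemannian_coord], [smooth_riemannian_pullback]). The point at issue is
    that two lifts pt and pt' of p, possibly with different index sets I and I',
    give the same tensor ([local_pullback_unique]).

    Extend both lifts to all indices i, by x_i = 0 outside the index set. The
    extra summands vanish, so both tensors are sums over I `|` I', and it
    suffices to compare them index by index. By definition of the quotient, the
    functions x_i of the two lifts coincide on the common domain, which is open,
    hence so do their derivatives. Fix a point u. If x_i(u) = 0, the factor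
    x_i(u)^2 kills the term that involves g_i. If x_i(u) <> 0, then x_i does not
    vanish near u by continuity, so the two lifts have the same g_i near u, and
    therefore the same dg_i at u ([metric_summand_near]). The weight x_i^2 thus
    compensates exactly for the indeterminacy of g_i in the quotient.

    Since p has a lift around each point of U, the tensor so obtained is defined
    on all of U, is the only pullback, and inherits symmetry, bilinearity and
    smoothness, which are local, from the lifts. *)

(** * Calculus of maps of class C^k on open sets *)

Section LocalCalculus.
Context (R : realType) (V W : normedModType R).
Implicit Types (A B : set V) (f g : V -> W).

(** The germ of f at u determines the first-order expansion, and the uniqueness
    of the differential identifies its linear part. *)
Lemma near_eq_differentiable f g (u : V) :
  (\near u, f u = g u) -> differentiable f u -> differentiable g u.
Proof.
move=> fg df; have [dfc /eqaddoP fE] := (diff_locallyP u f).1 df.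
have gE : g \o shift u = cst (g u) + 'd f u +o_ 0 id.
  apply/eqaddoP => e e0; have := fE e e0; apply: filter_app.
  have : \forall y \near (0 : V), f (y + u) = g (y + u).
    have := fg; rewrite (near_shift 0 u); apply: filterS => y /=.
    by rewrite subr0.
  apply: filterS => y fgy; rewrite /= !fctE /= fgy.
  by rewrite (nbhs_singleton fg).
apply/diff_locallyP; rewrite (diff_unique dfc gE); split=> //.
Qed.

Lemma derive_linear_dir f (u : V) (c : R) (v v' : V) : differentiable f u ->
  'D_(c *: v + v') f u = c *: 'D_v f u + 'D_v' f u.
Proof. by move=> df; rewrite !deriveE// linearP. Qed.

Lemma open_near_eq A f g : open A -> {in A, f =1 g} ->
  forall u, A u -> \near u, f u = g u.
Proof.
move=> oA fg u Au; have : nbhs u A by exact: open_nbhs_nbhs.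
by apply: filterS => w Aw; apply: fg; rewrite inE.
Qed.

Lemma Ck_on_pred k A f : Ck_on k.+1 A f -> Ck_on k A f.
Proof.
elim: k f => [|k IH] f [df Df].
  by move=> u Au; apply: differentiable_continuous; exact: df.
by split=> // v; apply: IH.
Qed.

(** Being of class C^k is local because a directional derivative depends on the
    germ only; the functions g may vary with the point, which is what makes
    computations in charts possible. *)
Lemma Ck_on_local k A f :
  (forall u, A u -> exists B g,
     [/\ open B, B u, {in B, f =1 g} & Ck_on k B g]) -> Ck_on k A f.
Proof.
elim: k f => [|k IH] f loc /=.
  move=> u /loc[B [g [oB Bu fg gc]]].
  rewrite /prop_for /continuous_at (fg _ (mem_set Bu)).
  apply: cvg_trans (gc _ Bu); apply: near_eq_cvg.
  by apply: filterS (open_near_eq oB fg Bu) => w ->.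
split=> [u /loc[B [g [oB Bu fg [dg _]]]]|v].
  apply: near_eq_differentiable (dg _ Bu).
  by apply: filterS (open_near_eq oB fg Bu) => w ->.
apply: IH => u /loc[B [g [oB Bu fg [_ Dg]]]].
exists B, ('D_v g); split=> // [w|]; last exact: Dg; rewrite inE => Bw.
by apply: near_eq_derive; exact: open_near_eq Bw.
Qed.

Lemma Ck_on_eq k A f g : open A -> {in A, f =1 g} -> Ck_on k A g -> Ck_on k A f.
Proof. by move=> oA fg gk; apply: Ck_on_local => u Au; exists A, g. Qed.

Lemma Ck_on_cst k A (w : W) : Ck_on k A (cst w).
Proof.
elim: k w => [|k IH] w /=; first by move=> u _; exact: cvg_cst.
split=> // v; rewrite (_ : 'D_v (cst w) = cst 0)//.
by apply/funext => u; rewrite derive_cst.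
Qed.

Lemma Ck_on_add k A f g : open A ->
  Ck_on k A f -> Ck_on k A g -> Ck_on k A (f \+ g).
Proof.
move=> oA; elim: k f g => [|k IH] f g /=.
  by move=> fc gc u Au; apply: continuousD; [exact: fc|exact: gc].
move=> [df Df] [dg Dg]; split=> [u Au|v].
  by apply: differentiableD; [exact: df|exact: dg].
apply: (Ck_on_eq (g := 'D_v f \+ 'D_v g)) => //; last exact: IH.
move=> u; rewrite inE => Au.
by apply: deriveD; apply: diff_derivable; [exact: df|exact: dg].
Qed.

End LocalCalculus.

Section ScalarCalculus.
Context (R : realType) (V : normedModType R).
Implicit Types (A : set V) (f g : V -> R).

Lemma Ck_on_mul k A f g : open A ->
  Ck_on k A f -> Ck_on k A g -> Ck_on k A (f \* g).
Proof.
move=> oA; elim: k f g => [|k IH] f g /=.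
  by move=> fc gc u Au; apply: continuousM; [exact: fc|exact: gc].
move=> fk gk; have [df Df] := fk; have [dg Dg] := gk; split=> [u Au|v].
  by apply: differentiableM; [exact: df|exact: dg].
apply: (Ck_on_eq (g := (f \* 'D_v g) \+ (g \* 'D_v f))) => //.
  move=> u; rewrite inE => Au.
  by apply: deriveM; apply: diff_derivable; [exact: df|exact: dg].
by apply: Ck_on_add => //; apply: IH => //; exact: Ck_on_pred.
Qed.

Lemma Ck_on_sum k A (I : Type) (r : seq I) (F : I -> V -> R) : open A ->
  (forall i, Ck_on k A (F i)) -> Ck_on k A (fun u => \sum_(i <- r) F i u).
Proof.
move=> oA Fk; elim: r => [|i r IH].
  by under eq_fun do rewrite big_nil; exact: Ck_on_cst.
by under eq_fun do rewrite big_cons; exact: Ck_on_add.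
Qed.

Lemma Ck_on_coord k A n (f : V -> 'rV[R]_n) (j : 'I_n) : open A ->
  Ck_on k A f -> Ck_on k A (fun u => f u 0 j).
Proof.
move=> oA; elim: k f => [|k IH] f /=.
  move=> fc u Au.
  by apply: (continuous_comp (g := fun M : 'rV[R]_n => M 0 j));
    [exact: fc|exact: coord_continuous].
move=> [df Df]; split=> [u Au|v].
  by apply: (differentiable_comp (g := fun M : 'rV[R]_n => M 0 j));
    [exact: df|exact: differentiable_coord].
apply: (Ck_on_eq (g := fun u => 'D_v f u 0 j)) => //; last exact: IH.
move=> u; rewrite inE => Au.
by rewrite derive_mx ?mxE//; apply: diff_derivable; exact: df.
Qed.

Lemma derive_comp_rV (W : normedModType R) n (f : V -> 'rV[R]_n)
    (g : 'rV[R]_n -> W) (u v : V) :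
  differentiable f u -> differentiable g (f u) ->
  'D_v (g \o f) u = \sum_j 'D_v f u 0 j *: 'D_(delta_mx 0 j) g (f u).
Proof.
move=> df dg; rewrite deriveE; last exact: differentiable_comp.
rewrite diff_comp//= -(deriveE v df).
rewrite [X in 'd g (f u) X](row_sum_delta ('D_v f u)) linear_sum.
by apply: eq_bigr => j _; rewrite linearZ /= (deriveE _ dg).
Qed.

(** The chain rule expresses the derivatives of g \o f by those of f and the
    partial derivatives of g, which are again of class C^k, so the induction on
    k goes through g at a fixed f. *)
Lemma Ck_on_comp k A n (B : set 'rV[R]_n) (f : V -> 'rV[R]_n)
    (g : 'rV[R]_n -> R) : open A -> (forall u, A u -> B (f u)) ->
  Ck_on k A f -> Ck_on k B g -> Ck_on k A (g \o f).
Proof.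
move=> oA fAB; elim: k g => [|k IH] g /=.
  by move=> fc gc u Au; apply: continuous_comp; [exact: fc|exact/gc/fAB].
move=> fk; have [df Df] := fk; move=> [dg Dg]; split=> [u Au|v].
  by apply: differentiable_comp; [exact: df|exact/dg/fAB].
apply: (Ck_on_eq (g := fun u =>
    \sum_j 'D_v f u 0 j * 'D_(delta_mx 0 j) g (f u))) => //.
  move=> u; rewrite inE => Au.
  by apply: derive_comp_rV; [exact: df|exact/dg/fAB].
apply: Ck_on_sum => // j; apply: Ck_on_mul => //; first exact: Ck_on_coord.
by apply: (IH ('D_(delta_mx 0 j) g)) => //; exact: Ck_on_pred.
Qed.

End ScalarCalculus.

(** * Riemannian metrics along maps into a manifold *)

Lemma open_setI_preimage (S T : topologicalType) (A : set S) (B : set T)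
    (f : S -> T) :
  open A -> open B -> (forall u, A u -> {for u, continuous f}) ->
  open (A `&` f @^-1` B).
Proof.
move=> oA oB fc; rewrite openE => u [Au Bu]; apply: filterI.
  exact: open_nbhs_nbhs.
by apply: (fc _ Au); exact: open_nbhs_nbhs.
Qed.

Section ChartDifferentiable.
Context (R : realType) (m : nat) (M : manifoldType R m).
Local Notation atlas := (@atlas R m M).

(** The common ground of smooth maps into M and of inverse charts: what is needed
    for the pushforward to be linear with values in the tangent space. *)
Definition chart_differentiable (V : normedModType R) (f : V -> M) (u : V) :=
  {for u, continuous f} /\
  forall a : atlas, chart_dom a (f u) -> differentiable (chart a \o f) u.

Lemma differentiable_transition (a b : atlas) (q : M) :
  chart_dom a q -> chart_dom b q ->
  differentiable (chart b \o chart_inv a) (chart a q).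
Proof.
by move=> aq bq; apply: (chart_transition a b 1%N).1; exists q.
Qed.

Lemma smooth_into_differentiable (V : normedModType R) (A : set V)
    (f : V -> M) (u : V) :
  smooth_into A f -> A u -> chart_differentiable f u.
Proof.
by move=> [fc fs] Au; split=> [|a au]; [exact: fc|apply: (fs a 1%N).1].
Qed.

Lemma chart_inv_differentiable (a : atlas) (q : M) :
  chart_dom a q -> chart_differentiable (chart_inv a) (chart a q).
Proof.
move=> aq; split=> [|b].
  by apply: chart_inv_continuous; exists q.
by rewrite chartK // => bq; exact: differentiable_transition.
Qed.

(** Near u, chart b \o f factors through the chart a as the transition map after
    chart a \o f; continuity of f keeps it inside the domain of a. *)
Lemma derive_change_chart (V : normedModType R) (f : V -> M) (u v : V)
    (a b : atlas) :
  chart_differentiable f u -> chart_dom a (f u) -> chart_dom b (f u) ->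
  'D_v (chart b \o f) u =
  'D_('D_v (chart a \o f) u) (chart b \o chart_inv a) (chart a (f u)).
Proof.
move=> [fc fd] au bu.
have fE : \near u, (chart b \o f) u =
    ((chart b \o chart_inv a) \o (chart a \o f)) u.
  have : nbhs u (f @^-1` chart_dom a).
    by apply: fc; apply: open_nbhs_nbhs; split=> //; exact: chart_dom_open.
  by apply: filterS => w /= aw; rewrite chartK.
have dab := differentiable_transition au bu.
rewrite (near_eq_derive _ fE) deriveE.
  by rewrite diff_comp//= ?(deriveE _ dab)// ?(deriveE _ (fd _ au))//; exact: fd.
by apply: differentiable_comp => //; exact: fd.
Qed.

Lemma pushforward_in (V : normedModType R) (f : V -> M) (u v : V) (a : atlas) :
  chart_dom a (f u) -> pushforward f u v a = 'D_v (chart a \o f) u.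
Proof. by move=> au; rewrite /pushforward asboolT. Qed.

Lemma pushforward_out (V : normedModType R) (f : V -> M) (u v : V) (a : atlas) :
  ~ chart_dom a (f u) -> pushforward f u v a = 0.
Proof. by move=> au; rewrite /pushforward asboolF. Qed.

Lemma pushforward_tangent (V : normedModType R) (f : V -> M) (u v : V) :
  chart_differentiable f u -> tangent (f u) (pushforward f u v).
Proof.
move=> df; split=> [a b au bu|a au]; last exact: pushforward_out.
by rewrite !pushforward_in//; exact: derive_change_chart.
Qed.

Lemma pushforward_linear (V : normedModType R) (f : V -> M) (u : V) (c : R)
    (v v' : V) : chart_differentiable f u ->
  pushforward f u (c *: v + v') = c *: pushforward f u v + pushforward f u v'.
Proof.
move=> [_ fd]; apply/funext => a; rewrite !fctE.
have [au|au] := pselect (chart_dom a (f u)).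
  by rewrite !pushforward_in//; apply: derive_linear_dir; exact: fd.
by rewrite !pushforward_out// scaler0 addr0.
Qed.

Lemma tvec_scaleE (c : R) (xi : tvec M) (a : atlas) :
  (c *: xi) a = c *: xi a.
Proof. by []. Qed.

Lemma tangent0 (q : M) : tangent q 0.
Proof.
split=> // a b aq bq; rewrite deriveE ?linear0//.
exact: differentiable_transition.
Qed.

Lemma tangent_linear (q : M) (c : R) (xi eta : tvec M) :
  tangent q xi -> tangent q eta -> tangent q (c *: xi + eta).
Proof.
move=> [xiT xi0] [etaT eta0]; split=> [a b aq bq|a aq]; rewrite !fctE.
  rewrite derive_linear_dir; last exact: differentiable_transition.
  by rewrite -xiT// -etaT.
by rewrite xi0// eta0// scaler0 addr0.
Qed.

Lemma coord_field_tangent (a : atlas) (k : 'I_m) (q : M) :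
  chart_dom a q -> tangent q (coord_field a k (chart a q)).
Proof.
move=> aq; rewrite -{1}(chartK a q aq).
exact/pushforward_tangent/chart_inv_differentiable.
Qed.

(** Both sides are tangent vectors with the same coordinates in the chart a; in
    any other chart the change of coordinates is linear, so it can be expanded
    on the canonical basis. *)
Lemma pushforward_coord_field (V : normedModType R) (f : V -> M) (u v : V)
    (a : atlas) : chart_differentiable f u -> chart_dom a (f u) ->
  pushforward f u v = \sum_(k < m) 'D_v (chart a \o f) u 0 k *:
                                   coord_field a k (chart a (f u)).
Proof.
move=> df au; apply/funext => b; rewrite fct_sumE.
have [bu|bu] := pselect (chart_dom b (f u)); last first.
  rewrite pushforward_out// big1// => k _.
  by rewrite tvec_scaleE /coord_field pushforward_out ?scaler0// chartK.
rewrite pushforward_in// (derive_change_chart v df au bu).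
have dab := differentiable_transition au bu.
rewrite deriveE// [X in 'd _ _ X]row_sum_delta linear_sum.
apply: eq_bigr => k _; rewrite linearZ tvec_scaleE /coord_field /= -deriveE//.
by rewrite pushforward_in// chartK.
Qed.

Section Metric.
Context (ip : M -> tvec M -> tvec M -> R) (ipR : riemannian_metric ip).

(** Tangency of the partial sums has to be carried along the induction, since ip
    is known to be additive on tangent vectors only. *)
Lemma riemannian_suml (q : M) (n : nat) (c : 'I_n -> R) (xi : 'I_n -> tvec M)
    (eta : tvec M) : (forall k, tangent q (xi k)) -> tangent q eta ->
  ip q (\sum_k c k *: xi k) eta = \sum_k c k * ip q (xi k) eta.
Proof.
move=> xiT etaT.
suff [] : tangent q (\sum_k c k *: xi k) /\
  ip q (\sum_k c k *: xi k) eta = \sum_k c k * ip q (xi k) eta by [].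
have ip0 : ip q 0 eta = 0.
  have := riemannian_linear ipR (-1) (tangent0 q) (tangent0 q) etaT.
  by rewrite scaler0 addr0 mulN1r addNr.
elim/big_ind2: _ => [|x x' y y' [xT xE] [yT yE]|k _].
- by split=> //; exact: tangent0.
- have := riemannian_linear ipR 1 xT yT etaT; rewrite scale1r mul1r => ->.
  rewrite xE yE; split=> //.
  by have := tangent_linear 1 xT yT; rewrite scale1r.
- have := riemannian_linear ipR (c k) (xiT k) (tangent0 q) etaT.
  rewrite addr0 ip0 addr0 => ->; split=> //.
  by have := tangent_linear (c k) (xiT k) (tangent0 q); rewrite addr0.
Qed.

Lemma riemannian_coord (V : normedModType R) (f : V -> M) (u v w : V)
    (a : atlas) : chart_differentiable f u -> chart_dom a (f u) ->
  ip (f u) (pushforward f u v) (pushforward f u w) =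
  \sum_(k < m) \sum_(l < m)
    'D_v (chart a \o f) u 0 k * ('D_w (chart a \o f) u 0 l *
      ip (chart_inv a (chart a (f u))) (coord_field a l (chart a (f u)))
                                       (coord_field a k (chart a (f u)))).
Proof.
move=> df au; rewrite chartK//.
have cT k := coord_field_tangent k au.
have pT := pushforward_tangent _ df.
rewrite {1}(pushforward_coord_field v df au) riemannian_suml//.
apply: eq_bigr => k _; rewrite -mulr_sumr; congr (_ * _).
rewrite (riemannian_sym ipR)// (pushforward_coord_field w df au).
by rewrite riemannian_suml.
Qed.

(** Around each point, read f in one chart: the function is then a polynomial in
    partial derivatives of chart a \o f and in the metric coefficients composed
    with chart a \o f. *)
Lemma smooth_riemannian_pullback (V : normedModType R) (A : set V) (f : V -> M)
    (v w : V) : open A -> smooth_into A f ->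
  smooth_on A (fun u => ip (f u) (pushforward f u v) (pushforward f u w)).
Proof.
move=> oA fs k; apply: Ck_on_local => u0 Au0; pose a := chart_at (f u0).
have au0 : chart_dom a (f u0) by exact: projT2 (cid (chart_cover (f u0))).
pose B := A `&` f @^-1` chart_dom a.
have oB : open B.
  by apply: open_setI_preimage => //; [exact: chart_dom_open|exact: fs.1].
have Ds x i : Ck_on k B (fun u => 'D_x (chart a \o f) u 0 i).
  by apply: Ck_on_coord => //; exact: (fs.2 a k.+1).2.
exists B; eexists; split; [exact: oB|by split| |].
  move=> u /set_mem[Au au]; apply: riemannian_coord au.
  exact: smooth_into_differentiable Au.
apply: Ck_on_sum => // i; apply: Ck_on_sum => // j.
apply: Ck_on_mul => //; apply: Ck_on_mul => //.
apply: (Ck_on_comp (B := chart_cod a) (f := chart a \o f) (g := fun y =>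
  ip (chart_inv a y) (coord_field a j y) (coord_field a i y))) => //.
- by move=> u [_ au]; exists (f u).
- exact: (fs.2 a k).
- exact: (riemannian_smooth ipR a j i k).
Qed.

End Metric.
End ChartDifferentiable.

(** * Pullback of the metric of the Milnor space *)

Section ExtensionByZero.
Context (R : realType) (G : groupType).
Implicit Types (I : {fset nat}).

Lemma ext_coef_in I (x : {ffun I -> R}) (i : I) : ext_coef x (val i) = x i.
Proof. by rewrite fsfun_ffun valK. Qed.

Lemma ext_coef_out I (x : {ffun I -> R}) (i : nat) :
  i \notin I -> ext_coef x i = 0.
Proof. by move=> iI; rewrite fsfun_ffun insubN. Qed.

Lemma ext_elt_in I (gam : {ffun I -> G}) (i : I) : ext_elt gam (val i) = gam i.
Proof. by rewrite /ext_elt valK. Qed.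

Lemma psi_eq I I' (z : sphere R I * {ffun I -> G})
    (z' : sphere R I' * {ffun I' -> G}) : psi z = psi z' ->
  forall i, ext_coef z.1 i = ext_coef z'.1 i /\
    (ext_coef z.1 i != 0 -> ext_elt z.2 i = ext_elt z'.2 i).
Proof.
move=> /eqmodP/asboolP /= [zc ze] i; split=> [|/ze//].
by rewrite zc.
Qed.

End ExtensionByZero.

Section Pullback.
Context (R : realType) (m : nat) (G : lieGroupType R m).
Context (ip : G -> tvec G -> tvec G -> R).
Context (n : nat).
Implicit Types (I : {fset nat}) (U V : set 'rV[R]_n).
Implicit Types (x y : 'rV[R]_n -> R) (g h : 'rV[R]_n -> G).
Implicit Types (u v w : 'rV[R]_n).

(** The contribution of one index to the pullback metric, for functions x and g
    that need not come from a lift. *)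
Definition metric_summand x g u v w : R :=
  'D_v x u * 'D_w x u +
  x u ^+ 2 * ip (g u) (pushforward g u v) (pushforward g u w).

Lemma near_eq_pushforward g h u v :
  (\near u, g u = h u) -> pushforward g u v = pushforward h u v.
Proof.
move=> gh; apply/funext => a.
rewrite /pushforward (nbhs_singleton gh); case: asboolP => // au.
by apply: near_eq_derive; apply: filterS gh => w /= ->.
Qed.

(** The germs of g and h at u only matter when x u <> 0, since the weight x u ^+ 2
    vanishes otherwise; and then x stays nonzero around u, so that these germs
    agree. *)
Lemma metric_summand_near x y g h u v w :
  {for u, continuous x} -> (\near u, x u = y u) ->
  (\near u, x u != 0 -> g u = h u) ->
  metric_summand x g u v w = metric_summand y h u v w.
Proof.
move=> xc xy gh.
rewrite /metric_summand -!(near_eq_derive _ xy) -(nbhs_singleton xy).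
have [xu0|xu0] := eqVneq (x u) 0; first by rewrite xu0 expr0n !mul0r.
have gh' : \near u, g u = h u.
  by apply: filterS2 gh (cvgr_neq0 _ xc xu0) => z gz /gz.
by rewrite -(nbhs_singleton gh') -!(near_eq_pushforward _ gh').
Qed.

Lemma metric_summand0 g u v w : metric_summand (fun=> 0) g u v w = 0.
Proof. by rewrite /metric_summand !derive_cst expr0n !mul0r addr0. Qed.

Section Summand.
Context (V : set 'rV[R]_n) (x : 'rV[R]_n -> R) (g : 'rV[R]_n -> G).
Context (oV : open V) (xs : smooth_on V x) (gs : smooth_into V g).
Context (ipR : riemannian_metric ip).

Lemma metric_summand_sym u v w : V u ->
  metric_summand x g u v w = metric_summand x g u w v.
Proof.
move=> Vu; have dg := smooth_into_differentiable gs Vu.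
rewrite /metric_summand [in LHS]mulrC; congr (_ + _ * _).
by apply: (riemannian_sym ipR); exact: pushforward_tangent.
Qed.

Lemma metric_summand_linearl u (c : R) v v' w : V u ->
  metric_summand x g u (c *: v + v') w =
  c * metric_summand x g u v w + metric_summand x g u v' w.
Proof.
move=> Vu; have dg := smooth_into_differentiable gs Vu.
have gT := pushforward_tangent _ dg.
rewrite /metric_summand pushforward_linear// (riemannian_linear ipR)//.
rewrite derive_linear_dir; last exact: (xs 1%N).1.
by rewrite mulrDl mulrDr addrACA -scalerAl mulrCA -mulrDr.
Qed.

Lemma metric_summand_smooth v w :
  smooth_on V (fun u => metric_summand x g u v w).
Proof.
move=> k; apply: Ck_on_add => //; apply: Ck_on_mul => //.
- exact: (xs k.+1).2.
- exact: (xs k.+1).2.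
- by apply: Ck_on_mul => //; exact: xs.
- exact: smooth_riemannian_pullback.
Qed.

End Summand.

Lemma local_pullback_summands I (pt : 'rV[R]_n -> sphere R I * {ffun I -> G})
    u v w :
  local_pullback ip pt u v w = \sum_(i : I)
    metric_summand (fun z => (pt z).1 i) (fun z => (pt z).2 i) u v w.
Proof. by rewrite big_split. Qed.

(** Extending the components of a lift to all indices in nat puts lifts with
    different index sets on the same footing. *)
Definition lift_coef I (pt : 'rV[R]_n -> sphere R I * {ffun I -> G}) i :=
  fun u => ext_coef (pt u).1 i.
Definition lift_elt I (pt : 'rV[R]_n -> sphere R I * {ffun I -> G}) i :=
  fun u => ext_elt (pt u).2 i.

Lemma lift_coef_in I (pt : 'rV[R]_n -> sphere R I * {ffun I -> G}) (i : I) :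
  lift_coef pt (val i) = fun u => (pt u).1 i.
Proof. by apply/funext => u; exact: ext_coef_in. Qed.

Lemma lift_coef_out I (pt : 'rV[R]_n -> sphere R I * {ffun I -> G}) i :
  i \notin I -> lift_coef pt i = fun=> 0.
Proof. by move=> iI; apply/funext => u; exact: ext_coef_out. Qed.

Lemma lift_elt_in I (pt : 'rV[R]_n -> sphere R I * {ffun I -> G}) (i : I) :
  lift_elt pt (val i) = fun u => (pt u).2 i.
Proof. by apply/funext => u; exact: ext_elt_in. Qed.

(** The indices in J outside I contribute nothing, their coefficient being
    identically zero; J serves as a common index set for two lifts. *)
Lemma local_pullbackE I J (pt : 'rV[R]_n -> sphere R I * {ffun I -> G}) u v w :
  (I `<=` J)%fset ->
  local_pullback ip pt u v w =
  \sum_(i <- J) metric_summand (lift_coef pt i) (lift_elt pt i) u v w.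
Proof.
move=> IJ; rewrite -(big_fset_incl _ IJ) => [|i _ iI]; last first.
  by rewrite lift_coef_out// metric_summand0.
rewrite big_seq_fsetE local_pullback_summands.
by apply: eq_bigr => i _; rewrite lift_coef_in lift_elt_in.
Qed.

Section Lift.
Context I (V : set 'rV[R]_n) (pt : 'rV[R]_n -> sphere R I * {ffun I -> G}).
Context (oV : open V) (ptV : smooth_lift V pt).

Lemma lift_coef_continuous i u : V u -> {for u, continuous (lift_coef pt i)}.
Proof.
move=> Vu; have [iI|iI] := boolP (i \in I).
  by rewrite (lift_coef_in pt [` iI]%fset); exact: (ptV.1 _ 0%N).
by rewrite lift_coef_out//; apply: cst_continuous.
Qed.

Context (ipR : riemannian_metric ip).

Lemma local_pullback_sym u v w : V u ->
  local_pullback ip pt u v w = local_pullback ip pt u w v.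
Proof.
move=> Vu; rewrite !local_pullback_summands; apply: eq_bigr => i _.
exact: (metric_summand_sym _ (ptV.2 i)).
Qed.

Lemma local_pullback_linearl u (c : R) v v' w : V u ->
  local_pullback ip pt u (c *: v + v') w =
  c * local_pullback ip pt u v w + local_pullback ip pt u v' w.
Proof.
move=> Vu; rewrite !local_pullback_summands mulr_sumr -big_split.
apply: eq_bigr => i _.
exact: (metric_summand_linearl (ptV.1 i) (ptV.2 i)).
Qed.

Lemma local_pullback_smooth v w :
  smooth_on V (fun u => local_pullback ip pt u v w).
Proof.
move=> k; under eq_fun do rewrite local_pullback_summands.
apply: Ck_on_sum => // i.
exact: (metric_summand_smooth oV (ptV.1 i) (ptV.2 i)).
Qed.

End Lift.

(** Over I `|` I' the summands agree one by one, because the two lifts have the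
    same image under psi on the whole open set V `&` V', so that their components
    can be compared as germs and not only at u. *)
Lemma local_pullback_unique (p : 'rV[R]_n -> Esph R G) I I' V V'
    (pt : 'rV[R]_n -> sphere R I * {ffun I -> G})
    (pt' : 'rV[R]_n -> sphere R I' * {ffun I' -> G}) u v w :
  open V -> open V' -> is_lift p V pt -> is_lift p V' pt' -> V u -> V' u ->
  local_pullback ip pt u v w = local_pullback ip pt' u v w.
Proof.
move=> oV oV' [pts ptp] [pts' ptp'] Vu Vu'.
have eqn : \near u, forall i, lift_coef pt i u = lift_coef pt' i u /\
    (lift_coef pt i u != 0 -> lift_elt pt i u = lift_elt pt' i u).
  have nV : nbhs u V by exact: open_nbhs_nbhs.
  have nV' : nbhs u V' by exact: open_nbhs_nbhs.
  by apply: filterS2 nV nV' => z Vz Vz'; apply: psi_eq; rewrite -ptp// ptp'.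
rewrite (local_pullbackE pt _ _ _ (fsubsetUl I I')).
rewrite (local_pullbackE pt' _ _ _ (fsubsetUr I I')).
apply: eq_bigr => i _; apply: metric_summand_near.
- exact: lift_coef_continuous Vu.
- by apply: filterS eqn => z /(_ i)[].
- by apply: filterS eqn => z /(_ i)[].
Qed.

End Pullback.

Theorem proposition6p6 (R : realType) (m : nat) (G : lieGroupType R m)
  (ip : G -> tvec G -> tvec G -> R)
  (ip_riemannian : riemannian_metric ip)
  (ip_right_invariant : right_invariant ip)
  (n : nat) (U : set 'rV[R]_n) (p : 'rV[R]_n -> Esph R G)
  (p_plot : plot U p) :
  exists T : 'rV[R]_n -> 'rV[R]_n -> 'rV[R]_n -> R,
    [/\ is_pullback ip U p T,
        (forall T', is_pullback ip U p T' ->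
           forall u v w, U u -> T' u v w = T u v w) &
        smooth_symmetric_tensor U T].
Proof.
(* All lifts around u give the same value, so the choice of one is harmless. *)
pose values u v w : set R := [set t | exists (V : set 'rV[R]_n)
  (I : {fset nat}) (pt : 'rV[R]_n -> sphere R I * {ffun I -> G}),
  [/\ open V, V u, is_lift p V pt & t = local_pullback ip pt u v w]].
pose T u v w := xget 0 (values u v w).
have TE : is_pullback ip U p T.
  move=> V I pt oV _ ptV u v w Vu.
  have : values u v w (T u v w).
    by apply: (xgetI 0 (x := local_pullback ip pt u v w)); exists V, I, pt.
  move=> [V' [I' [pt' [oV' Vu' ptV' ->]]]].
  exact: local_pullback_unique ptV' ptV Vu' Vu.
have locT u : U u -> exists V I (pt : 'rV[R]_n -> sphere R I * {ffun I -> G}),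
    [/\ open V, V u, V `<=` U, is_lift p V pt &
      forall z v w, V z -> T z v w = local_pullback ip pt z v w].
  move=> /p_plot.2[V [oV Vu VU [I [pt ptV]]]].
  by exists V, I, pt; split=> // z v w; exact: TE.
exists T; split; first exact: TE.
  move=> T' T'E u v w /locT[V [I [pt [oV Vu VU ptV TV]]]].
  by rewrite TV//; exact: T'E ptV _ _ _ Vu.
have Tsym u v w : U u -> T u v w = T u w v.
  move=> /locT[V [I [pt [oV Vu VU [ptV _] TV]]]].
  rewrite (TV _ v w Vu) (TV _ w v Vu).
  exact: (local_pullback_sym ptV ip_riemannian v w Vu).
have Tlin u (c : R) v v' w : U u ->
    T u (c *: v + v') w = c * T u v w + T u v' w.
  move=> /locT[V [I [pt [oV Vu VU [ptV _] TV]]]].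
  rewrite (TV _ _ _ Vu) (TV _ v w Vu) (TV _ v' w Vu).
  exact: (local_pullback_linearl ptV ip_riemannian c v v' w Vu).
split; [exact: Tlin| |exact: Tsym|] => [u c v w w' Uu|i j k].
  by rewrite !(Tsym u v _ Uu) Tlin.
apply: Ck_on_local => u /locT[V [I [pt [oV Vu VU [ptV _] TV]]]].
exists V, (fun z => local_pullback ip pt z (delta_mx 0 i) (delta_mx 0 j)).
split; [exact: oV|exact: Vu|by move=> z /set_mem Vz; exact: TV|].
exact: (local_pullback_smooth oV ptV ip_riemannian).
Qed.
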